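(* Let $\nu\ge 0$. For every real $\alpha>-1$ and every integer $n\ge 1$, the type 2 multiple orthogonal polynomials $p_{n,m}^{\alpha}$ for the pair of weights $(\rho_\nu,\rho_{\nu+1})$ satisfy $$\frac{d}{dx}\,p_{n,n}^{\alpha}(x)=2n\,p_{n,n-1}^{\alpha+1}(x),\qquad \frac{d}{dx}\,p_{n,n-1}^{\alpha}(x)=(2n-1)\,p_{n-1,n-1}^{\alpha+1}(x).$$
   Context: $K_\nu$ is the Macdonald function (modified Bessel function of the second kind), given for $z>0$ by $K_\nu(z)=\frac12\left(\frac z2\right)^{\nu}\int_0^\infty \exp\left(-t-\frac{z^2}{4t}\right)t^{-\nu-1}\,dt$. For $x>0$ the scaled Macdonald function is $\rho_\nu(x)=2x^{\nu/2}K_\nu(2\sqrt{x})$. Throughout $\nu\ge 0$. For nonnegative integers $n,m$ and $\alpha>-1$, the type 2 multiple orthogonal polynomial $p_{n,m}^{\alpha}$ (with $\nu$ fixed) is the monic polynomial of degree $n+m$ satisfying $$\int_0^\infty p_{n,m}^{\alpha}(x)\rho_\nu(x)x^{k+\alpha}\,dx=0,\quad k=0,1,\ldots,n-1,$$ $$\int_0^\infty p_{n,m}^{\alpha}(x)\rho_{\nu+1}(x)x^{k+\alpha}\,dx=0,\quad k=0,1,\ldots,m-1.$$ For the indices used here ($m=n$ or $m=n-1$) this polynomial exists and is unique. *)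

(* Defs.v *)
From HB Require Import structures.
From mathcomp Require Export all_boot all_order all_algebra.
From mathcomp Require Export all_classical all_reals all_analysis.
Export Order.TTheory GRing.Theory Num.Theory.
Export numFieldNormedType.Exports.

Set Implicit Arguments.
Unset Strict Implicit.
Unset Printing Implicit Defensive.

Local Open Scope classical_set_scope.
Local Open Scope ring_scope.

(* Meaningful for z > 0, where the integral converges for every nu. *)
Definition macdonald (R : realType) (nu z : R) : R :=
  2^-1 * (z / 2) `^ nu *
  \int[lebesgue_measure]_(t in `]0, +oo[)
    (expR (- t - z ^+ 2 / (4 * t)) * t `^ (- nu - 1)).

Definition scaled_macdonald (R : realType) (nu x : R) : R :=
  2 * x `^ (nu / 2) * macdonald nu (2 * Num.sqrt x).

(* The orthogonality integrals are taken in the extended reals: the real-valued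
   Rintegral also sends infinite integrals to 0. *)
Record type2_mop (R : realType) (nu alpha : R) (n m : nat) (p : {poly R})
    : Prop := Type2Mop {
  type2_mop_monic : p \is monic;
  type2_mop_size : size p = (n + m).+1;
  type2_mop_orth1 : forall k : nat, (k < n)%N ->
    (\int[lebesgue_measure]_(x in `]0%R, +oo[)
      (p.[x] * scaled_macdonald nu x * x `^ (k%:R + alpha))%:E = 0)%E;
  type2_mop_orth2 : forall k : nat, (k < m)%N ->
    (\int[lebesgue_measure]_(x in `]0%R, +oo[)
      (p.[x] * scaled_macdonald (nu + 1) x * x `^ (k%:R + alpha))%:E = 0)%E
}.

(* Main.v *)
Require Import Defs.
From mathcomp Require Import measurable_realfun ring lra zify.
Local Open Scope ring_scope.

(** Integrating x^m against rho_nu and exchanging the order of integration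
    turns the Macdonald weight into a product of two Gamma integrals: the
    moment of order m is Gamma(m+1) Gamma(m+nu+1)
    ([integral_scaled_macdonald]).  The functional equation of Gamma then
    couples the moments A_i of x^alpha rho_nu with the moments B_i of
    x^alpha rho_(nu+1) by
      B_i = (alpha+nu+1+i) A_i   and   A_(i+1) = (alpha+1+i) B_i,
    and raising alpha by one just shifts both sequences by one index
    ([coupled_macdonald_moments]).

    From there on the theorem is linear algebra.  Write L and M for the two
    moment functionals.  The coupling says that L(x^(k+1) p') is a combination
    of M(x^k p) and L(x^k p), and that M(x^(k+1) p') is a combination of
    L(x^(k+1) p) and M(x^k p).  Hence if p satisfies the first N+1
    orthogonality conditions, taken in the alternating order L, M, L, M and so
    on, its derivative satisfies the first N conditions for alpha+1
    ([stepline_orth_deriv]).  The index pairs (n,n) and (n,n-1) are exactly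
    this alternating path, with N = 2n and N = 2n-1, so both formulas of the
    theorem are the same statement p_N' = N p_(N-1).

    The same lemma proves uniqueness ([stepline_orth_eq0]): if deg r < N and r
    satisfies N conditions, then r' satisfies N-1 conditions with
    deg r' < N-1, so r' = 0 by induction; r is constant, and its zeroth moment
    forces r = 0.  Applying this to p_N' - N p_(N-1), whose leading terms
    cancel, gives the theorem ([stepline_deriv]). *)

Set Implicit Arguments.
Unset Strict Implicit.
Unset Printing Implicit Defensive.

(** * Polynomials orthogonal for two coupled moment sequences *)

Section MomentSum.
Context {R : realFieldType}.
Implicit Types (A B : nat -> R) (p q : {poly R}).

Definition moment_sum A p := \sum_(i < size p) p`_i * A i.

Lemma moment_sum_widen N A p : (size p <= N)%N ->
  moment_sum A p = \sum_(i < N) p`_i * A i.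
Proof.
move=> pN; rewrite /moment_sum (big_ord_widen _ (fun i => p`_i * A i) pN).
rewrite big_mkcond; apply: eq_bigr => i _; case: ltnP => // pi.
by rewrite nth_default ?mul0r.
Qed.

Lemma moment_sumB A p q :
  moment_sum A (p - q) = moment_sum A p - moment_sum A q.
Proof.
pose N := maxn (size p) (size q).
rewrite !(@moment_sum_widen N) ?leq_maxl ?leq_maxr//; last first.
  by apply: leq_trans (size_polyD _ _) _; rewrite size_polyN.
by rewrite -sumrB; apply: eq_bigr => i _; rewrite coefB mulrBl.
Qed.

Lemma moment_sumZ A c p : moment_sum A (c *: p) = c * moment_sum A p.
Proof.
rewrite (@moment_sum_widen (size p)) ?size_scale_leq// mulr_sumr.
by apply: eq_bigr => i _; rewrite coefZ mulrA.
Qed.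

Lemma moment_sum_deriv A p :
  moment_sum A p^`() = moment_sum (fun i => i%:R * A i.-1) p.
Proof.
rewrite [RHS](@moment_sum_widen (size p).+1)// big_ord_recl mul0r mulr0 add0r.
rewrite (@moment_sum_widen (size p)); last first.
  exact: leq_trans (size_poly _ _) (leq_pred _).
by apply: eq_bigr => i _; rewrite coef_deriv -[_ *+ _]mulr_natr -mulrA.
Qed.

Lemma moment_sum_lin A B C c p : (forall i, A i = B i - c * C i) ->
  moment_sum A p = moment_sum B p - c * moment_sum C p.
Proof.
move=> ABC; rewrite /moment_sum mulr_sumr -sumrB; apply: eq_bigr => i _.
by rewrite ABC; ring.
Qed.

End MomentSum.

Section Stepline.
Context {R : realFieldType}.
Implicit Types (A B : nat -> R) (p q : {poly R}).

(** In terms of the functionals L and M with moments A and B, the two relations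
    read M(f) = L(b f + x f') and L(x f) = M(a f + x f'). *)
Record coupled_moments (a b : R) A B : Prop := CoupledMoments {
  coupled_snd : forall i, B i = (b + i%:R) * A i;
  coupled_shift : forall i, A i.+1 = (a + i%:R) * B i }.

(** The first N of the conditions A, B, A, B, ... applied to p, x p, x^2 p,
    ...: the indices (n,m) with m = n or m = n-1 are parametrised by
    N = n + m, which makes a single induction on N possible. *)
Definition stepline_orth A B N p :=
  (forall k, (k < uphalf N)%N -> moment_sum (fun i => A (i + k)%N) p = 0) /\
  (forall k, (k < N./2)%N -> moment_sum (fun i => B (i + k)%N) p = 0).

(** Shifting the moments corresponds to multiplying the weights by x. *)
Lemma coupled_momentsS a b A B : coupled_moments a b A B ->
  coupled_moments (a + 1) (b + 1) (fun i => A i.+1) (fun i => B i.+1).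
Proof.
by move=> [hB hA]; split=> i /=; [rewrite hB|rewrite hA]; rewrite -natr1; ring.
Qed.

(** The coefficient i of x p' is i p_i, and the coupling relations rewrite
    i A_(i+k) as B_(i+k) - (b+k) A_(i+k), and i B_(i+k) as
    A_(i+k+1) - (a+k) B_(i+k).  The first needs index k in both families,
    the second index k in B and k+1 in A: exactly one condition is lost in the
    alternating order. *)
Lemma stepline_orth_deriv a b A B N p : coupled_moments a b A B ->
  stepline_orth A B N.+1 p ->
  stepline_orth (fun i => A i.+1) (fun i => B i.+1) N p^`().
Proof.
move=> [hB hA] [oA oB]; split=> k kN; rewrite moment_sum_deriv.
- rewrite (@moment_sum_lin _ _ (fun i => B (i + k)%N) (fun i => A (i + k)%N)
    (b + k%:R)).
    by rewrite oA ?oB ?mulr0 ?subr0//; lia.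
  (* At i = 0 the left side uses the junk value 0.-1 = 0, with factor 0. *)
  move=> [|i]; first by rewrite mul0r hB; ring.
  by rewrite hB /= -addSn natrD; ring.
- rewrite (@moment_sum_lin _ _ (fun i => A (i + k.+1)%N)
    (fun i => B (i + k)%N) (a + k%:R)).
    by rewrite oA ?oB ?mulr0 ?subr0//; lia.
  move=> [|i]; rewrite addnS hA; first by rewrite mul0r; ring.
  by rewrite /= -addSn natrD; ring.
Qed.

(** Uniqueness: differentiation lowers both the degree bound and the number of
    conditions by one, so everything reduces to a constant polynomial tested
    against A_0, which is nonzero. *)
Lemma stepline_orth_eq0 N a b A B p : coupled_moments a b A B ->
  (forall i, A i != 0) -> stepline_orth A B N p -> (size p <= N)%N -> p = 0.
Proof.
elim: N a b A B p => [|N IH] a b A B p cAB A0 oAB pN.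
  by apply/eqP; rewrite -size_poly_leq0.
have dp0 : p^`() = 0.
  have := IH _ _ _ _ p^`() (coupled_momentsS cAB) (fun i => A0 i.+1).
  apply; first exact: stepline_orth_deriv cAB oAB.
  by apply: leq_trans (size_poly _ _) _; case: (size p) pN.
have pC : p = (p`_0)%:P.
  apply/polyP => -[|i]; rewrite coefC//=; apply/eqP.
  have /eqP := congr1 (fun q : {poly R} => q`_i) dp0.
  by rewrite coef_deriv coef0 mulrn_eq0.
have := oAB.1 0%N isT; rewrite (@moment_sum_widen _ 1) ?big_ord1; last first.
  by rewrite pC size_polyC leq_b1.
by move/eqP; rewrite mulf_eq0 (negPf (A0 _)) orbF => /eqP p0; rewrite pC p0.
Qed.

(** The leading terms of p' and (N+1) q agree, so their difference has degree
    less than N and satisfies N conditions. *)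
Lemma stepline_deriv N a b A B p q : coupled_moments a b A B ->
  (forall i, A i != 0) ->
  p \is monic -> size p = N.+2 -> stepline_orth A B N.+1 p ->
  q \is monic -> size q = N.+1 ->
  stepline_orth (fun i => A i.+1) (fun i => B i.+1) N q ->
  p^`() = N.+1%:R *: q.
Proof.
move=> cAB A0 /monicP; rewrite /lead_coef => lp sp op /monicP.
rewrite /lead_coef => lq sq oq.
rewrite sp/= in lp; rewrite sq/= in lq.
apply/subr0_eq/(@stepline_orth_eq0 N _ _ _ _ _ (coupled_momentsS cAB)).
- by move=> i; exact: A0.
- have od := stepline_orth_deriv cAB op.
  split=> k kN; rewrite moment_sumB moment_sumZ.
    by rewrite od.1// oq.1// mulr0 subr0.
  by rewrite od.2// oq.2// mulr0 subr0.
- apply/leq_sizeP => i; rewrite leq_eqVlt => /predU1P[<-|Ni].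
    by rewrite coefB coefZ coef_deriv lp lq mulr1 subrr.
  by rewrite coefB coefZ coef_deriv !nth_default ?sp ?sq// mulr0 mul0rn subr0.
Qed.

End Stepline.

(** * Integrals of nonnegative functions on the half line *)

Section HalfLineIntegrals.
Local Open Scope classical_set_scope.
Local Open Scope ring_scope.
Context {R : realType}.
Notation mu := (@lebesgue_measure R).

(** The image of Lebesgue measure under x |-> c x, rescaled by c, agrees with
    Lebesgue measure on intervals, hence everywhere.  Going through the measure
    rather than through a substitution rule for continuous functions allows
    integrands that blow up at 0. *)
Lemma ge0_integral_scale (c : R) (f : R -> \bar R) : 0 < c ->
  measurable_fun `](0:R), +oo[ f -> (forall x, 0 < x -> (0 <= f x)%E) ->
  (\int[mu]_(x in `]0%R, +oo[) f (c * x)%R =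
   (c^-1)%:E * \int[mu]_(x in `]0%R, +oo[) f x)%E.
Proof.
move=> c0 mf f0.
have mc : measurable_fun [set: measurableTypeR R]
    ( *%R c : measurableTypeR R -> measurableTypeR R).
  exact: measurable_funM.
pose pm : {measure set (measurableTypeR R) -> \bar R} :=
  measure_function_pushforward__canonical__measure_function_Measure mu mc.
have -> : (\int[mu]_(x in `]0%R, +oo[) f (c * x)%R =
    \int[pm]_(x in `]0%R, +oo[) f x)%E.
  rewrite ge0_integral_pushforward//; last first.
    by move=> y; rewrite inE/= in_itv/= andbT => /f0.
  congr integral; apply/seteqP; split=> x /=; rewrite !in_itv/= !andbT;
    by rewrite pmulr_rgt0.
pose k : {nonneg R} := NngNum (ltW c0).
have muE A : measurable A -> mu A = (c%:E * pm A)%E.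
  move=> mA; apply: (@lebesgue_measure_unique R (mscale k pm)) => //.
  move=> X [[a b] _ <-]; rewrite /mscale/=.
  transitivity (c%:E * mu `](a / c)%R, (b / c)%R]%classic)%E; last first.
    congr (_ * mu _)%E; apply/seteqP; split=> x /=;
      by rewrite !in_itv/= ltr_pdivrMr// ler_pdivlMr// mulrC.
  rewrite !lebesgue_measure_itv/= !lte_fin ltr_pM2r ?invr_gt0//.
  case: ifPn => _; last by rewrite mule0.
  by rewrite -!EFinD -EFinM -mulrBl mulrC divfK ?gt_eqF.
(* The image measure is mu multiplied by the constant 1 / c. *)
pose k' : {nonneg R} := NngNum (ltW (divr_gt0 ltr01 c0)).
have -> : c^-1 = k'%:num by rewrite /= div1r.
rewrite -(ge0_integral_mscale mu _ k')//; last first.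
  by move=> x; rewrite /= in_itv/= andbT => /f0.
apply: eq_measure_integral => A mA _.
transitivity ((k'%:num)%:E * (c%:E * pm A))%E.
  by rewrite /= muleA -EFinM div1r mulVf ?gt_eqF// mul1e.
by congr (_ * _)%E; exact: esym (muE A mA).
Qed.

(** The fundamental theorem of calculus on ]0, b] for a derivative that may be
    singular at 0: exhaust ]0, b] by compact intervals and use monotone
    convergence. *)
Lemma ge0_FTC_oc (f F : R -> R) (b l : R) : 0 < b ->
  (forall x : R, 0 < x <= b -> 0 <= f x) ->
  (forall x : R, 0 < x -> {for x, continuous f}) ->
  (forall x : R, 0 < x -> is_derive x 1 F (f x)) ->
  F x @[x --> (0:R)^'+] --> l ->
  (\int[mu]_(x in `]0%R, b]) (f x)%:E = (F b - l)%:E)%E.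
Proof.
move=> b0 f0 cf dF Fl.
have cF (x : R) : 0 < x -> {for x, continuous F}.
  move=> x0; apply: differentiable_continuous; apply/derivable1_diffP.
  by have [] := dF x x0.
(* The denominator n + 2 keeps a n strictly below b from the start. *)
pose a n : R := b / n.+2%:R.
have a0 n : 0 < a n by rewrite divr_gt0.
have ab n : a n < b.
  by rewrite ltr_pdivrMr// ltr_pMr// ltr1n.
have acvg : a n @[n --> \oo] --> (0 : R).
  rewrite -(mulr0 b); apply: cvgMl_tmp.
  by have := @cvg_harmonic R; rewrite -cvg_shiftS.
have IE n : (\int[mu]_(x in `[a n, b]) (f x)%:E = (F b - F (a n))%:E)%E.
  rewrite EFinB; apply: continuous_FTC2 => //.
  - apply/continuous_within_itvP => //; split.
    + by move=> x; rewrite in_itv/= => /andP[ax _]; apply: cf; exact: lt_trans ax.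
    + by apply: cvg_at_right_filter; exact: cf.
    + by apply: cvg_at_left_filter; exact: cf.
  - split.
    + move=> x; rewrite in_itv/= => /andP[ax _].
      by have [] := dF x (lt_trans (a0 n) ax).
    + by apply: cvg_at_right_filter; exact: cF.
    + by apply: cvg_at_left_filter; exact: cF.
  - move=> x; rewrite in_itv/= => /andP[ax _].
    by rewrite derive1E; have [_ ->] := dF x (lt_trans (a0 n) ax).
have UE : \bigcup_n `[a n, b]%classic = `]0, b]%classic.
  apply/seteqP; split=> x; rewrite /bigcup/=.
    by move=> [n _ /=]; rewrite !in_itv/= => /andP[+ ->]; move/(lt_le_trans (a0 n)) ->.
  rewrite in_itv/= => /andP[x0 xb].
  have [n _ nx] := (cvgr_lt _ acvg) _ x0.
  exists n => //=; rewrite in_itv/= xb andbT.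
  by apply/ltW/nx => /=.
have limI : (\int[mu]_(x in `[a n, b]) (f x)%:E)%E @[n --> \oo] -->
    (\int[mu]_(x in `]0%R, b]) (f x)%:E)%E.
  rewrite -UE; apply: ge0_nondecreasing_set_cvg_integral => //.
  - move=> n m nm; rewrite subsetEset; apply: subset_itvr.
    rewrite bnd_simp ler_pM2l// lef_pV2 ?posrE// ler_nat; lia.
  - move=> n; apply/measurable_EFinP.
    apply: (@measurable_funS _ _ _ _ `](0:R), +oo[) => //.
      by move=> x /=; rewrite !in_itv/= andbT => /andP[+ _]; exact: lt_le_trans.
    apply: open_continuous_measurable_fun => //.
    by move=> x; rewrite inE/= in_itv/= andbT; exact: cf.
  - move=> n x /=; rewrite in_itv/= => /andP[ax xb]; rewrite lee_fin.
    by rewrite f0// xb (lt_le_trans (a0 n)).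
have limF : (\int[mu]_(x in `[a n, b]) (f x)%:E)%E @[n --> \oo] -->
    (F b - l)%:E.
  apply: cvg_EFin; first by apply: nearW => n; rewrite IE.
  have -> : fine \o (fun n => (\int[mu]_(x in `[a n, b]) (f x)%:E)%E) =
      (fun n => F b - F (a n)) by apply/funext => n /=; rewrite IE.
  apply: cvgB; first exact: cvg_cst.
  by have /cvg_at_rightP := Fl; apply.
by apply: cvg_unique limI limF.
Qed.

Lemma ge0_integral_split (b : R) (f : R -> \bar R) : 0 < b ->
  measurable_fun `](0:R), +oo[ f -> (forall x, 0 < x -> (0 <= f x)%E) ->
  (\int[mu]_(x in `]0%R, +oo[) f x =
   \int[mu]_(x in `]0%R, b]) f x + \int[mu]_(x in `[b, +oo[) f x)%E.
Proof.
move=> b0 mf f0.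
have E : `](0:R), +oo[%classic = `](0:R), b] `|` `]b, +oo[.
  by rewrite -itv_bndbnd_setU// bnd_simp// ltW.
rewrite [in LHS]E ge0_integral_setU//; last first.
- by apply/disj_setPRL => x /=; rewrite !in_itv/= andbT ltNge => /negP bx /andP[_ /bx].
- by move=> x; rewrite -E/= in_itv/= andbT => /f0.
- by rewrite -E.
rewrite -integral_itv_obnd_cbnd//; apply: measurable_funS mf => //.
by move=> x /=; rewrite !in_itv/= !andbT; exact: lt_trans.
Qed.

End HalfLineIntegrals.

(** * The Gamma integral *)

Section Gamma.
Local Open Scope classical_set_scope.
Local Open Scope ring_scope.
Context {R : realType}.
Notation mu := (@lebesgue_measure R).

Definition gamma_fun (s x : R) := x `^ (s - 1) * expR (- x).

Definition gamma_integral (s : R) : \bar R :=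
  (\int[mu]_(x in `]0%R, +oo[) (gamma_fun s x)%:E)%E.

Lemma gamma_fun_ge0 s x : 0 <= gamma_fun s x.
Proof. by rewrite mulr_ge0 ?powR_ge0 ?expR_ge0. Qed.

Lemma measurable_gamma_fun s : measurable_fun [set: R] (gamma_fun s).
Proof.
apply: measurable_funM; first exact: measurable_powR.
by apply: measurableT_comp => //.
Qed.

Lemma gt0_powRD (x r t : R) : 0 < x -> x `^ (r + t) = x `^ r * x `^ t.
Proof. by move=> x0; rewrite powRD// (gt_eqF x0) implybT. Qed.

Lemma gamma_funS (s x : R) : 0 < x -> gamma_fun (s + 1) x = x * gamma_fun s x.
Proof.
move=> x0; rewrite /gamma_fun addrK mulrA -[s in LHS](subrK 1).
by rewrite (@gt0_powRD x (s - 1) 1)// powRr1 ?ltW// [x * _]mulrC.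
Qed.

(** From y <= exp y at y = x/(2s): then x^s <= (2s)^s exp(x/2), which leaves
    half of the exponential decay.  This gives the limit at infinity, the
    finiteness of Gamma, and the bound on the Macdonald integrand. *)
Lemma gamma_funS_le_expR (s : R) : 0 < s ->
  exists2 C, 0 <= C &
    forall x, 0 < x -> gamma_fun (s + 1) x <= C * expR (- (x / 2)).
Proof.
move=> s0; exists ((2 * s) `^ s); first exact: powR_ge0.
move=> x x0; rewrite /gamma_fun addrK.
have -> : expR (- x) = expR (- (x / 2)) * expR (- (x / 2)).
  by rewrite -expRD; congr expR; field.
rewrite mulrA; apply: ler_wpM2r; first exact: expR_ge0.
have xle : x <= 2 * s * expR (x / (2 * s)).
  rewrite -ler_pdivrMl ?mulr_gt0// mulrC.
  by apply: le_trans (expR_ge1Dx _); lra.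
rewrite expRN ler_pdivrMr ?expR_gt0//.
apply: (@le_trans _ _ ((2 * s * expR (x / (2 * s))) `^ s)).
  apply: ge0_ler_powR => //; first exact: ltW.
    by rewrite nnegrE ltW.
  by rewrite nnegrE; apply: le_trans xle; exact: ltW.
rewrite (@powRM _ (2 * s) (expR _)) ?expR_ge0 ?mulr_ge0 ?(ltW s0)//.
rewrite -expRM. apply: ler_wpM2l; rewrite ?powR_ge0// ler_expR.
by rewrite le_eqVlt; apply/orP; left; apply/eqP; field; rewrite gt_eqF.
Qed.

Lemma is_derive_gamma_funS (s x : R) : 0 < x ->
  is_derive x 1 (gamma_fun (s + 1)) ((s - x) * gamma_fun s x).
Proof.
move=> x0; rewrite /gamma_fun addrK.
have dp : is_derive x 1 (@powR R ^~ s) (s * x `^ (s - 1)).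
  exact: is_derive1_powR.
have de : is_derive x 1 (fun x : R => expR (- x)) (- expR (- x)).
  apply: is_derive_eq.
  by rewrite mulrN1.
have -> : (s - x) * (x `^ (s - 1) * expR (- x)) =
    x `^ s *: - expR (- x) + expR (- x) *: (s * x `^ (s - 1)).
  have -> : x `^ s = x `^ (s - 1) * x.
    by rewrite -[in LHS](subrK 1 s) (gt0_powRD (s - 1) 1)// powRr1 ?ltW.
  by rewrite /GRing.scale/=; ring.
exact: is_deriveM.
Qed.

Lemma continuous_gamma_fun (s x : R) : 0 < x -> {for x, continuous (gamma_fun s)}.
Proof.
move=> x0; have := is_derive_gamma_funS (s - 1) x0; rewrite subrK => -[dg _].
by apply: differentiable_continuous; apply/derivable1_diffP.
Qed.

Lemma gamma_funS_cvg0 (s : R) : 0 < s -> gamma_fun (s + 1) x @[x --> (0:R)^'+] --> 0.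
Proof.
move=> s0; rewrite /gamma_fun addrK -[X in _ --> X](mul0r (expR (- 0))).
apply: cvgM; first exact: powR_cvg0.
apply: cvg_at_right_filter.
apply: continuous_comp; [exact: continuousN|exact: continuous_expR].
Qed.

Lemma gamma_funS_cvgy (s : R) : 0 < s -> gamma_fun (s + 1) x @[x --> +oo] --> 0.
Proof.
move=> s0; have [C C0 hC] := gamma_funS_le_expR s0.
apply: (@squeeze_cvgr _ _ _ _ (cst 0) (fun x => C * expR (- (x / 2)))).
- near=> x; rewrite gamma_fun_ge0/=; apply: hC.
  by near: x; exact: nbhs_pinfty_gt.
- exact: cvg_cst.
- rewrite -(mulr0 C); apply: cvgMl_tmp.
  apply: (@cvg_comp _ _ _ (fun x => x / 2) (fun x => expR (- x)) _ +oo).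
    exact: gt0_cvgMly.
  exact: cvgr_expR.
Unshelve. all: by end_near. Qed.

(** The integrand is the derivative of x^s exp(-x), nonnegative up to s. *)
Lemma integral_gamma_fun_lower (s : R) : 0 < s ->
  (\int[mu]_(x in `]0%R, s]) ((s - x) * gamma_fun s x)%:E =
   (gamma_fun (s + 1) s)%:E)%E.
Proof.
move=> s0; rewrite -[gamma_fun (s + 1) s]subr0.
apply: (ge0_FTC_oc s0 _ _ (is_derive_gamma_funS s) (gamma_funS_cvg0 s0)) => x.
  by move=> /andP[x0 xs]; rewrite mulr_ge0 ?gamma_fun_ge0// subr_ge0.
move=> x0; apply: cvgM; last exact: continuous_gamma_fun.
by apply: cvgB; [exact: cvg_cst|exact: cvg_id].
Qed.

(** Integration by parts with h(x) = x^s exp(-x) and h' = (s-x) x^(s-1)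
    exp(-x).  The derivative changes sign at s; splitting the half line there
    keeps both pieces of constant sign, so the identity holds in the extended
    reals before anything is known to be finite.  The boundary terms h(s) of
    the two pieces cancel. *)
Lemma gamma_integralS (s : R) : 0 < s ->
  (gamma_integral (s + 1) = s%:E * gamma_integral s)%E.
Proof.
move=> s0.
have mg t (D : set R) : measurable D ->
    measurable_fun D (fun x => (gamma_fun t x)%:E).
  move=> mD; apply/measurable_EFinP/measurable_funTS.
  exact: measurable_gamma_fun.
have g0 t x : (0 <= (gamma_fun t x)%:E)%E by rewrite lee_fin gamma_fun_ge0.
have splitE t : gamma_integral t =
    (\int[mu]_(x in `]0%R, s]) (gamma_fun t x)%:E +
     \int[mu]_(x in `[s, +oo[) (gamma_fun t x)%:E)%E.
  by apply: ge0_integral_split => //; exact: mg.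
have mdg (D : set R) : measurable D ->
    measurable_fun D (fun x => ((s - x) * gamma_fun s x)%:E).
  move=> mD; apply/measurable_EFinP/measurable_funTS.
  apply: measurable_funM; last exact: measurable_gamma_fun.
  exact: measurable_funB.
have lower : (s%:E * \int[mu]_(x in `]0%R, s]) (gamma_fun s x)%:E =
    (gamma_fun (s + 1) s)%:E +
    \int[mu]_(x in `]0%R, s]) (gamma_fun (s + 1) x)%:E)%E.
  rewrite -integral_gamma_fun_lower//.
  rewrite -ge0_integralD//; [|..]; last 3 first.
  - move=> x /=; rewrite in_itv/= => /andP[x0 xs].
    by rewrite lee_fin mulr_ge0 ?gamma_fun_ge0// subr_ge0.
  - exact: mdg.
  - exact: mg.
  rewrite -ge0_integralZl_EFin//; [|exact: mg|exact: ltW].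
  apply: eq_integral => x; rewrite inE/= in_itv/= => /andP[x0 _].
  by rewrite -EFinD -EFinM gamma_funS//; congr EFin; ring.
have upper : (\int[mu]_(x in `[s, +oo[) (gamma_fun (s + 1) x)%:E =
    (gamma_fun (s + 1) s)%:E +
    s%:E * \int[mu]_(x in `[s, +oo[) (gamma_fun s x)%:E)%E.
  have -> : ((gamma_fun (s + 1) s)%:E =
      \int[mu]_(x in `[s, +oo[) ((x - s) * gamma_fun s x)%:E)%E.
    have dN (x : R) : s <= x -> is_derive x 1 (- gamma_fun (s + 1)) ((x - s) * gamma_fun s x).
      move=> sx; rewrite -opprB mulNr; apply: is_deriveN.
      by apply: is_derive_gamma_funS; exact: lt_le_trans sx.
    rewrite (@ge0_continuous_FTC2y _ _ (- gamma_fun (s + 1)) _ 0).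
    - by rewrite sub0e -EFinN opprK.
    - by move=> x sx; rewrite mulr_ge0 ?gamma_fun_ge0// subr_ge0.
    - apply/continuous_within_itvcyP; split.
        move=> x; rewrite in_itv/= andbT => /(lt_trans s0) x0.
        apply: cvgM; last exact: continuous_gamma_fun.
        by apply: cvgB; [exact: cvg_id|exact: cvg_cst].
      apply: cvg_at_right_filter; apply: cvgM; last exact: continuous_gamma_fun.
      by apply: cvgB; [exact: cvg_id|exact: cvg_cst].
    - by rewrite -oppr0; apply: cvgN; exact: gamma_funS_cvgy.
    - by move=> x /ltW /dN [].
    - by apply: cvg_at_right_filter; apply: cvgN; exact: continuous_gamma_fun.
    - move=> x; rewrite in_itv/= andbT => /ltW /dN [_ <-].
      by rewrite derive1E.
  rewrite -ge0_integralZl_EFin//; [|exact: mg|exact: ltW].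
  rewrite -ge0_integralD//; [|..]; last 4 first.
  - move=> x /=; rewrite in_itv/= andbT => sx.
    by rewrite lee_fin mulr_ge0 ?gamma_fun_ge0// subr_ge0.
  - apply/measurable_EFinP/measurable_funTS.
    apply: measurable_funM; last exact: measurable_gamma_fun.
    exact: measurable_funB.
  - by move=> x _; rewrite mule_ge0// lee_fin ltW.
  - by apply: measurable_funeM; exact: mg.
  apply: eq_integral => x; rewrite inE/= in_itv/= andbT => sx.
  rewrite -EFinM -EFinD gamma_funS; last exact: lt_le_trans sx.
  by congr EFin; ring.
rewrite !splitE upper [RHS]ge0_muleDr; [|exact: integral_ge0|exact: integral_ge0].
by rewrite lower addeA [X in (X + _)%E = _]addeC.
Qed.

(** On ]0, s] the integrand of s Gamma(s) dominates the derivative of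
    x^s exp(-x), whose integral is explicit and positive. *)
Lemma gamma_integral_gt0 (s : R) : 0 < s -> (0 < gamma_integral s)%E.
Proof.
move=> s0; rewrite -(@pmule_rgt0 _ s%:E)// ?lte_fin//.
apply: (@lt_le_trans _ _ (gamma_fun (s + 1) s)%:E).
  by rewrite lte_fin gamma_funS// !mulr_gt0// ?powR_gt0// expR_gt0.
rewrite -integral_gamma_fun_lower// -ge0_integralZl_EFin//; last 3 first.
- by move=> x _; rewrite lee_fin gamma_fun_ge0.
- apply/measurable_EFinP/measurable_funTS; exact: measurable_gamma_fun.
- exact: ltW.
apply: (@le_trans _ _ (\int[mu]_(x in `]0%R, s]) (s%:E * (gamma_fun s x)%:E))%E).
  apply: ge0_le_integral => //.
  - move=> x /=; rewrite in_itv/= => /andP[x0 xs].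
    by rewrite lee_fin mulr_ge0 ?gamma_fun_ge0// subr_ge0.
  - apply/measurable_EFinP/measurable_funTS.
    apply: measurable_funM; last exact: measurable_gamma_fun.
    exact: measurable_funB.
  - apply: measurable_funeM; apply/measurable_EFinP/measurable_funTS.
    exact: measurable_gamma_fun.
  - move=> x /=; rewrite in_itv/= => /andP[x0 xs].
    by rewrite lee_fin ler_wpM2r ?gamma_fun_ge0// gerBl ltW.
apply: ge0_subset_integral => //.
- apply: measurable_funeM; apply/measurable_EFinP/measurable_funTS.
  exact: measurable_gamma_fun.
- by move=> x _; rewrite mule_ge0// lee_fin ?gamma_fun_ge0 ?ltW.
- by move=> x /=; rewrite !in_itv/= andbT => /andP[].
Qed.

Lemma integral_expR_half_lty : (\int[mu]_(x in `]0%R, +oo[) (expR (- (x / 2)))%:E < +oo)%E.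
Proof.
have h0 : (0 : R) < 2^-1 by [].
have := integral_exponential_pdf h0.
have /integrableP[mp _] := integrable_exponential_pdf h0.
move=> E.
apply: (@le_lt_trans _ _ (2%:E * \int[mu]_x (exponential_pdf 2^-1 x)%:E)%E); last first.
  by rewrite E mule1 ltry.
rewrite -ge0_integralZl_EFin//; last first.
  by move=> x _; rewrite lee_fin exponential_pdf_ge0// ltW.
apply: (@le_trans _ _ (\int[mu]_(x in `]0%R, +oo[) (2%:E * (exponential_pdf 2^-1 x)%:E))%E).
  rewrite le_eqVlt; apply/orP; left; apply/eqP/eq_integral => x.
  rewrite inE/= in_itv/= andbT => x0; rewrite exponential_pdfE ?ltW// -EFinM.
  by congr EFin; rewrite mulrA divff// mul1r; congr expR; rewrite mulNr mulrC.
apply: ge0_subset_integral => //; first exact: measurable_funeM.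
by move=> x _; rewrite mule_ge0// lee_fin exponential_pdf_ge0// ltW.
Qed.

(** Gamma(s+1) is finite by exponential decay, its integrand being bounded
    near 0; the functional equation transfers this to s in ]0, 1], where the
    integrand itself is unbounded. *)
Lemma gamma_integral_fin_num (s : R) : 0 < s -> gamma_integral s \is a fin_num.
Proof.
move=> s0.
have S1 : (gamma_integral (s + 1) < +oo)%E.
  have [C C0 hC] := gamma_funS_le_expR s0.
  apply: (@le_lt_trans _ _ (C%:E * \int[mu]_(x in `]0%R, +oo[) (expR (- (x / 2)))%:E)%E); last first.
    by apply: lte_mul_pinfty => //; exact: integral_expR_half_lty.
  have me : measurable_fun `](0:R), +oo[ (fun x : R => (expR (- (x / 2)))%:E).
    apply/measurable_EFinP/measurable_funTS; apply: measurableT_comp => //.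
    by apply: measurableT_comp => //; exact: measurable_funM.
  rewrite -ge0_integralZl_EFin//.
  apply: ge0_le_integral => //.
  - by move=> x _; rewrite lee_fin gamma_fun_ge0.
  - by apply/measurable_EFinP/measurable_funTS; exact: measurable_gamma_fun.
  - exact: measurable_funeM.
  - by move=> x /=; rewrite in_itv/= andbT => x0; rewrite -EFinM lee_fin hC.
have g0 := gamma_integral_gt0 s0.
rewrite ge0_fin_numE ?ltW// ltNge leye_eq; apply/negP => /eqP goo.
by move: S1; rewrite gamma_integralS// goo gt0_muley ?lte_fin.
Qed.

Definition gammaR (s : R) : R := fine (gamma_integral s).

Lemma gamma_integralE s : 0 < s -> gamma_integral s = (gammaR s)%:E.
Proof. by move=> s0; rewrite fineK// gamma_integral_fin_num. Qed.

Lemma gammaR_gt0 s : 0 < s -> 0 < gammaR s.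
Proof. by move=> s0; rewrite -lte_fin -gamma_integralE// gamma_integral_gt0. Qed.

Lemma gammaRS s : 0 < s -> gammaR (s + 1) = s * gammaR s.
Proof.
by move=> s0; rewrite /gammaR gamma_integralS// fineM// gamma_integral_fin_num.
Qed.

Lemma integral_powR_expR_scaled (s t : R) : 0 < t -> 0 < s ->
  (\int[mu]_(x in `]0%R, +oo[) (x `^ (s - 1) * expR (- (x / t)))%:E =
   (t `^ s * gammaR s)%:E)%E.
Proof.
move=> t0 s0.
have mg : measurable_fun `](0:R), +oo[ (fun x => (gamma_fun s x)%:E).
  by apply/measurable_EFinP/measurable_funTS; exact: measurable_gamma_fun.
have sc := @ge0_integral_scale R t^-1 _ _ mg.
transitivity (\int[mu]_(x in `]0%R, +oo[)
  ((t `^ (s - 1))%:E * (gamma_fun s (t^-1 * x))%:E))%E.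
  apply: eq_integral => x; rewrite inE/= in_itv/= andbT => x0.
  rewrite -EFinM; congr EFin; rewrite /gamma_fun mulrA -powRM ?ltW//; last first.
    by rewrite mulr_gt0 ?invr_gt0.
  by rewrite mulrA divff ?gt_eqF// mul1r [t^-1 * x]mulrC.
rewrite ge0_integralZl_EFin ?powR_ge0//; last 2 first.
- by move=> x _; rewrite lee_fin gamma_fun_ge0.
- apply/measurable_EFinP/measurable_funTS.
  by apply: measurableT_comp; [exact: measurable_gamma_fun|exact: measurable_funM].
rewrite sc ?invr_gt0//; last by move=> x _; rewrite lee_fin gamma_fun_ge0.
rewrite -/(gamma_integral s) gamma_integralE// -!EFinM invrK; congr EFin.
rewrite mulrA; congr (_ * _).
by rewrite -[in RHS](subrK 1 s) (gt0_powRD (s - 1) 1)// powRr1 ?ltW.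
Qed.

End Gamma.

(** * Tonelli's theorem on a rectangle *)

Section TonelliOn.
Local Open Scope classical_set_scope.
Local Open Scope ereal_scope.
Context d1 d2 (T1 : measurableType d1) (T2 : measurableType d2) (R : realType).
Context (m1 : {sigma_finite_measure set T1 -> \bar R}).
Context (m2 : {sigma_finite_measure set T2 -> \bar R}).
Context (A : set T1) (B : set T2) (f : T1 * T2 -> \bar R).
Context (mA : measurable A) (mB : measurable B).
Context (mf : measurable_fun (A `*` B) f).
Context (f0 : forall x y, A x -> B y -> 0 <= f (x, y)).

Let g := f \_ (A `*` B).

Let mg : measurable_fun setT g.
Proof. by apply/(measurable_restrictT f) => //; exact: measurableX. Qed.

Let g0 z : 0 <= g z.
Proof. by apply: erestrict_ge0 => -[x y] [/= Ax By]; exact: f0. Qed.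

Let gl x : A x -> \int[m2]_(y in B) f (x, y) = \int[m2]_y g (x, y).
Proof.
move=> Ax; rewrite integral_mkcond; apply: eq_integral => y _.
by rewrite /g !patchE in_setX (mem_set Ax).
Qed.

Let gr y : B y -> \int[m1]_(x in A) f (x, y) = \int[m1]_x g (x, y).
Proof.
move=> By; rewrite integral_mkcond; apply: eq_integral => x _.
by rewrite /g !patchE in_setX (mem_set By) andbT.
Qed.

Lemma measurable_fun_integral_on :
  measurable_fun A (fun x => \int[m2]_(y in B) f (x, y)).
Proof.
apply: (@eq_measurable_fun _ _ _ _ _ (fun x => \int[m2]_y g (x, y))).
  by move=> x; rewrite inE => /gl.
apply: measurable_funTS.
exact: (measurable_fun_fubini_tonelli_F g).
Qed.

Lemma fubini_tonelli_on :
  \int[m1]_(x in A) \int[m2]_(y in B) f (x, y) =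
  \int[m2]_(y in B) \int[m1]_(x in A) f (x, y).
Proof.
transitivity (\int[m1]_x \int[m2]_y g (x, y)).
  rewrite integral_mkcond; apply: eq_integral => x _; rewrite patchE.
  case: ifPn => [|Ax]; first by rewrite inE => /gl.
  rewrite integral0_eq// => y _.
  by rewrite /g patchE in_setX (negPf Ax).
rewrite fubini_tonelli//.
rewrite [RHS]integral_mkcond; apply: eq_integral => y _; rewrite patchE.
case: ifPn => [|By]; first by rewrite inE => /gr.
rewrite integral0_eq// => x _.
by rewrite /g patchE in_setX (negPf By) andbF.
Qed.
End TonelliOn.

(** * Moments of the Macdonald weights *)

Section Macdonald.
Local Open Scope classical_set_scope.
Local Open Scope ring_scope.
Context {R : realType}.
Notation mu := (@lebesgue_measure R).
Implicit Types nu x t : R.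

Definition macdonald_kernel nu x t := expR (- t - x / t) * t `^ (- nu - 1).

Lemma macdonald_kernel_ge0 nu x t : 0 <= macdonald_kernel nu x t.
Proof. by rewrite mulr_ge0 ?expR_ge0 ?powR_ge0. Qed.

Lemma measurable_macdonald_kernel nu :
  measurable_fun (`](0:R), +oo[ `*` `](0:R), +oo[)
    (fun z : R * R => macdonald_kernel nu z.1 z.2).
Proof.
(* On t > 0 the quotient is x * t `^ (-1), a measurable function of (x, t). *)
apply: (@eq_measurable_fun _ _ _ _ _ (fun z : R * R =>
    expR (- z.2 - z.1 * z.2 `^ (- 1)) * z.2 `^ (- nu - 1))).
  move=> [x t]; rewrite inE => -[_ /=]; rewrite in_itv/= andbT => t0.
  by rewrite /macdonald_kernel powR_inv1 ?ltW.
apply: measurable_funTS; apply: measurable_funM; last first.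
  exact: (measurableT_comp (measurable_powR (- nu - 1))).
apply: measurableT_comp => //; apply: measurable_funB.
  exact: measurableT_comp.
apply: measurable_funM => //.
exact: (measurableT_comp (measurable_powR (- 1))).
Qed.

Lemma measurable_macdonald_kernelr nu x :
  measurable_fun `](0:R), +oo[ (macdonald_kernel nu x).
Proof.
apply: (@eq_measurable_fun _ _ _ _ _ (fun t : R =>
    expR (- t - x * t `^ (- 1)) * t `^ (- nu - 1))).
  move=> t; rewrite inE/= in_itv/= andbT => t0.
  by rewrite /macdonald_kernel powR_inv1 ?ltW.
apply: measurable_funTS; apply: measurable_funM; last exact: measurable_powR.
apply: measurableT_comp => //; apply: measurable_funB => //.
by apply: measurable_funM => //; exact: measurable_powR.
Qed.

Lemma scaled_macdonaldE nu x : 0 < x -> scaled_macdonald nu x =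
  x `^ nu * fine (\int[mu]_(t in `]0%R, +oo[) (macdonald_kernel nu x t)%:E)%E.
Proof.
move=> x0; rewrite /scaled_macdonald /macdonald.
have -> : 2 * Num.sqrt x / 2 = x `^ 2^-1 by rewrite powR12_sqrt ?ltW// mulrC mulKf.
rewrite -powRrM [2^-1 * nu]mulrC.
rewrite [2 * _ * _](_ : _ = x `^ (nu / 2) * x `^ (nu / 2) *
  \int[mu]_(t in `]0%R, +oo[)
    (expR (- t - (2 * Num.sqrt x) ^+ 2 / (4 * t)) * t `^ (- nu - 1))); last by field.
rewrite -gt0_powRD// -splitr; congr (_ * _).
rewrite /Rintegral; congr fine; apply: eq_integral => t.
rewrite inE/= in_itv/= andbT => t0; congr (expR (_ - _) * _)%:E.
rewrite exprMn sqr_sqrtr ?ltW//; field; by rewrite gt_eqF.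
Qed.

(** With y = x/t the kernel is y^(nu+1) exp(-y) x^(-nu-1) exp(-t), and the
    first two factors are bounded.  Finiteness at every x > 0 matters because
    the definition of the Macdonald function sends an infinite integral
    to 0. *)
Lemma integral_macdonald_kernel_fin_num nu x : -1 < nu -> 0 < x ->
  (\int[mu]_(t in `]0%R, +oo[) (macdonald_kernel nu x t)%:E)%E \is a fin_num.
Proof.
move=> nu1 x0; have s0 : 0 < nu + 1 by rewrite -ltrBlDr sub0r.
have [C C0 hC] := gamma_funS_le_expR s0.
have m1 t (D : set R) : measurable D -> measurable_fun D (fun x => (gamma_fun t x)%:E).
  move=> mD; apply/measurable_EFinP/measurable_funTS.
  exact: measurable_gamma_fun.
rewrite ge0_fin_numE; last first.
  by apply: integral_ge0 => t _; rewrite lee_fin macdonald_kernel_ge0.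
apply: (@le_lt_trans _ _ ((C * x `^ (- nu - 1))%:E * gamma_integral 1)%E); last first.
  rewrite lte_mul_pinfty//; first by rewrite lee_fin mulr_ge0 ?powR_ge0.
  by rewrite -ge0_fin_numE ?gamma_integral_fin_num// ltW ?gamma_integral_gt0.
rewrite -ge0_integralZl_EFin//; [|..]; last 3 first.
- by move=> t _; rewrite lee_fin gamma_fun_ge0.
- exact: m1.
- by rewrite mulr_ge0 ?powR_ge0.
apply: ge0_le_integral => //.
- by move=> t _; rewrite lee_fin macdonald_kernel_ge0.
- by apply/measurable_EFinP; exact: measurable_macdonald_kernelr.
- by apply: measurable_funeM; exact: m1.
- move=> t /=; rewrite in_itv/= andbT => t0; rewrite -EFinM lee_fin -mulrA.
  have xt0 : 0 < x / t by rewrite divr_gt0.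
  have := hC _ xt0; rewrite /gamma_fun addrK subrr powRr0 mul1r => hxt.
  have {hxt} : (x / t) `^ (nu + 1) * expR (- (x / t)) <= C.
    apply: le_trans hxt _; rewrite -[leRHS]mulr1; apply: ler_wpM2l => //.
    by rewrite -expR0 ler_expR oppr_le0 ltW// divr_gt0.
  have -> : macdonald_kernel nu x t = (x / t) `^ (nu + 1) * expR (- (x / t)) *
      (x `^ (- nu - 1) * expR (- t)).
    have xx : x `^ (nu + 1) * x `^ (- nu - 1) = 1.
      by rewrite -gt0_powRD// -opprD subrr powRr0.
    have -> : (x / t) `^ (nu + 1) = x `^ (nu + 1) * t `^ (- nu - 1).
      rewrite powRM ?invr_ge0 ?ltW// -[t^-1]powR_inv1 ?ltW// -powRrM mulN1r.
      by rewrite opprD.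
    rewrite /macdonald_kernel expRD -[LHS]mul1r -[X in X * _ = _]xx; ring.
  move=> hxt; apply: ler_wpM2r hxt.
  by rewrite mulr_ge0 ?powR_ge0 ?expR_ge0.
Qed.

Definition macdonald_moment nu (m : R) := gammaR (m + 1) * gammaR (m + nu + 1).

Lemma measurable_scaled_macdonald nu : -1 < nu ->
  measurable_fun `](0:R), +oo[ (@scaled_macdonald R nu).
Proof.
move=> nu1.
apply: (@eq_measurable_fun _ _ _ _ _ (fun x => x `^ nu *
  fine (\int[mu]_(t in `]0%R, +oo[) (macdonald_kernel nu x t)%:E)%E)).
  by move=> x; rewrite inE/= in_itv/= andbT => /scaled_macdonaldE.
apply: measurable_funM; first by apply: measurable_funTS; exact: measurable_powR.
apply: measurableT_comp; first exact: fine_measurable.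
apply: (@measurable_fun_integral_on _ _ _ _ _ mu `](0:R), +oo[ `](0:R), +oo[
  (fun z : R * R => (macdonald_kernel nu z.1 z.2)%:E)) => //.
- by apply/measurable_EFinP; exact: measurable_macdonald_kernel.
- by move=> x y _ _; rewrite lee_fin macdonald_kernel_ge0.
Qed.

Lemma scaled_macdonald_ge0 nu x : 0 < x -> 0 <= scaled_macdonald nu x.
Proof.
move=> x0; rewrite scaled_macdonaldE// mulr_ge0 ?powR_ge0// fine_ge0//.
by apply: integral_ge0 => t _; rewrite lee_fin macdonald_kernel_ge0.
Qed.

(** By Tonelli: integrating x^(m+nu) exp(-x/t) in x first gives
    t^(m+nu+1) Gamma(m+nu+1), and the powers of t left over combine to the
    integrand t^m exp(-t) of Gamma(m+1). *)
Lemma integral_scaled_macdonald nu (m : R) : -1 < nu -> -1 < m -> -1 < m + nu ->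
  (\int[mu]_(x in `]0%R, +oo[) (scaled_macdonald nu x * x `^ m)%:E =
   (macdonald_moment nu m)%:E)%E.
Proof.
move=> nu1 m1 mnu1.
pose f (z : R * R) := (z.1 `^ (m + nu) * macdonald_kernel nu z.1 z.2)%:E.
have mf : measurable_fun (`](0:R), +oo[ `*` `](0:R), +oo[) f.
  apply/measurable_EFinP; apply: measurable_funM; last exact: measurable_macdonald_kernel.
  apply: measurable_funTS.
  exact: (measurableT_comp (measurable_powR (m + nu))).
transitivity (\int[mu]_(x in `]0%R, +oo[) \int[mu]_(t in `]0%R, +oo[) f (x, t))%E.
  apply: eq_integral => x; rewrite inE/= in_itv/= andbT => x0.
  under eq_integral do rewrite /f/= EFinM.
  rewrite ge0_integralZl_EFin ?powR_ge0//; [|..]; last 2 first.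
  - by move=> t _; rewrite lee_fin macdonald_kernel_ge0.
  - by apply/measurable_EFinP; exact: measurable_macdonald_kernelr.
  rewrite -[X in (_ * X)%E]fineK ?integral_macdonald_kernel_fin_num//.
  rewrite -EFinM scaled_macdonaldE// gt0_powRD//; congr EFin; ring.
rewrite fubini_tonelli_on//; last first.
  by move=> x y _ _; rewrite lee_fin mulr_ge0 ?powR_ge0 ?macdonald_kernel_ge0.
have a0 : 0 < m + nu + 1 by rewrite -ltrBlDr sub0r.
have b0 : 0 < m + 1 by rewrite -ltrBlDr sub0r.
transitivity (\int[mu]_(t in `]0%R, +oo[)
  ((gammaR (m + nu + 1))%:E * (gamma_fun (m + 1) t)%:E))%E.
  apply: eq_integral => t; rewrite inE/= in_itv/= andbT => t0.
  transitivity (\int[mu]_(x in `]0%R, +oo[) ((expR (- t) * t `^ (- nu - 1))%:E *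
    (x `^ (m + nu + 1 - 1) * expR (- (x / t)))%:E))%E.
    apply: eq_integral => x _; rewrite -EFinM; congr EFin.
    by rewrite /macdonald_kernel /= addrK expRD; ring.
  rewrite ge0_integralZl_EFin//; [|..]; last 3 first.
  - by move=> x _; rewrite lee_fin mulr_ge0 ?powR_ge0 ?expR_ge0.
  - apply/measurable_EFinP/measurable_funTS; apply: measurable_funM.
      exact: measurable_powR.
    apply: measurableT_comp => //; apply: measurableT_comp => //.
    exact: measurable_funM.
  - by rewrite mulr_ge0 ?powR_ge0 ?expR_ge0.
  rewrite integral_powR_expR_scaled// -!EFinM; congr EFin.
  rewrite /gamma_fun.
  have -> : m + 1 - 1 = (- nu - 1) + (m + nu + 1) by ring.
  by rewrite (gt0_powRD (- nu - 1) (m + nu + 1))//; ring.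
rewrite ge0_integralZl_EFin//; [|..]; last 3 first.
- by move=> t _; rewrite lee_fin gamma_fun_ge0.
- by apply/measurable_EFinP/measurable_funTS; exact: measurable_gamma_fun.
- by rewrite ltW// gammaR_gt0.
by rewrite -/(gamma_integral _) gamma_integralE// -EFinM mulrC.
Qed.
End Macdonald.

(** * Type 2 multiple orthogonal polynomials *)

Section MultipleOrthogonality.
Local Open Scope classical_set_scope.
Local Open Scope ring_scope.
Context {R : realType}.
Notation mu := (@lebesgue_measure R).
Implicit Types (nu alpha : R) (p q : {poly R}).

(** Every monomial is integrable against the weight, so the extended-real
    orthogonality integrals are genuine finite linear combinations of
    moments. *)
Lemma integral_poly_scaled_macdonald nu alpha k p : 0 <= nu -> -1 < alpha ->
  (\int[mu]_(x in `]0%R, +oo[)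
     (p.[x] * scaled_macdonald nu x * x `^ (k%:R + alpha))%:E =
   (moment_sum (fun i => macdonald_moment nu (alpha + (i + k)%:R)) p)%:E)%E.
Proof.
move=> nu0 alpha1.
pose w i x := scaled_macdonald nu x * x `^ (alpha + (i + k)%:R).
have m1 i : -1 < alpha + (i + k)%:R.
  by apply: lt_le_trans alpha1 _; rewrite lerDl.
have nu1 : -1 < nu by apply: lt_le_trans nu0.
have wE i : (\int[mu]_(x in `]0%R, +oo[) (w i x)%:E =
    (macdonald_moment nu (alpha + (i + k)%:R))%:E)%E.
  apply: integral_scaled_macdonald => //.
  by apply: lt_le_trans (m1 i) _; rewrite lerDl.
have wint i : mu.-integrable `]0%R, +oo[ (EFin \o w i).
  apply/integrableP; split.
    apply/measurable_EFinP; apply: measurable_funM.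
      exact: measurable_scaled_macdonald.
    by apply: measurable_funTS; exact: measurable_powR.
  suff -> : (\int[mu]_(x in `]0%R, +oo[) `|(w i x)%:E| =
      \int[mu]_(x in `]0%R, +oo[) (w i x)%:E)%E by rewrite wE ltry.
  apply: eq_integral => x; rewrite inE/= in_itv/= andbT => x0.
  by rewrite ger0_norm// mulr_ge0 ?powR_ge0// scaled_macdonald_ge0.
transitivity (\int[mu]_(x in `]0%R, +oo[)
    \sum_(i < size p) (p`_i)%:E * (EFin \o w i) x)%E.
  apply: eq_integral => x; rewrite inE/= in_itv/= andbT => x0.
  rewrite horner_coef mulr_suml mulr_suml sumEFin; congr EFin.
  apply: eq_bigr => i _.
  have xik : x `^ (alpha + (i + k)%:R) = x ^+ i * x `^ (k%:R + alpha).
    rewrite -powR_mulrn ?ltW// -gt0_powRD//; congr (_ `^ _).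
    by rewrite natrD; ring.
  by rewrite /w xik; move: (scaled_macdonald nu x) => r; ring.
rewrite integral_sum//; last by move=> i; exact: integrableZl.
rewrite /moment_sum -sumEFin; apply: eq_bigr => i _.
by rewrite integralZl// wE EFinM.
Qed.

(** Both relations are the functional equation of Gamma, applied to one of the
    two Gamma factors at a time. *)
Lemma coupled_macdonald_moments nu alpha : 0 <= nu -> -1 < alpha ->
  coupled_moments (alpha + 1) (alpha + nu + 1)
    (fun i => macdonald_moment nu (alpha + i%:R))
    (fun i => macdonald_moment (nu + 1) (alpha + i%:R)).
Proof.
move=> nu0 alpha1.
have a0 i : 0 < alpha + i%:R + 1 by have := ler0n R i; lra.
split=> i; rewrite /macdonald_moment.
  have -> : alpha + i%:R + (nu + 1) + 1 = (alpha + i%:R + nu + 1) + 1 by ring.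
  by rewrite (@gammaRS _ (alpha + i%:R + nu + 1)); [ring|have := a0 i; lra].
rewrite -[i.+1%:R]natr1 [alpha + (_ + _)]addrA gammaRS//.
have -> : alpha + i%:R + 1 + nu + 1 = alpha + i%:R + (nu + 1) + 1 by ring.
by ring.
Qed.

Lemma type2_mop_stepline_orth nu alpha N p : 0 <= nu -> -1 < alpha ->
  type2_mop nu alpha (uphalf N) N./2 p ->
  stepline_orth (fun i => macdonald_moment nu (alpha + i%:R))
    (fun i => macdonald_moment (nu + 1) (alpha + i%:R)) N p.
Proof.
move=> nu0 alpha1 [_ _ o1 o2]; split=> k kN; apply: EFin_inj.
  by rewrite -integral_poly_scaled_macdonald// o1.
by rewrite -integral_poly_scaled_macdonald ?o2// addr_ge0.
Qed.

(** Both formulas of the theorem at once, the index pair being the N-th point of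
    the path (0,0), (1,0), (1,1), (2,1), ... *)
Lemma type2_mop_deriv nu alpha N p q : 0 <= nu -> -1 < alpha ->
  type2_mop nu alpha (uphalf N.+1) N.+1./2 p ->
  type2_mop nu (alpha + 1) (uphalf N) N./2 q ->
  p^`() = N.+1%:R *: q.
Proof.
move=> nu0 alpha1 hp hq.
have sizeE M : (uphalf M + M./2 = M)%N by rewrite uphalf_half -addnA addnn odd_double_half.
apply: (stepline_deriv (coupled_macdonald_moments nu0 alpha1)).
- move=> i; have := ler0n R i => i0; rewrite gt_eqF// /macdonald_moment.
  by rewrite mulr_gt0// gammaR_gt0//; lra.
- by case: hp.
- by rewrite (type2_mop_size hp) sizeE.
- exact: type2_mop_stepline_orth.
- by case: hq.
- by rewrite (type2_mop_size hq) sizeE.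
- have alpha2 : -1 < alpha + 1 by lra.
  have := type2_mop_stepline_orth nu0 alpha2 hq.
  have e i : alpha + 1 + i%:R = alpha + i.+1%:R by rewrite -natr1; ring.
  by under eq_fun do rewrite e; under [X in stepline_orth _ X]eq_fun do rewrite e.
Qed.

Lemma derive1_horner p x : (fun y : R => p.[y])^`()%classic x = p^`().[x].
Proof. by rewrite derivE. Qed.

End MultipleOrthogonality.

Unset Implicit Arguments.

Theorem theorem1 (R : realType) (nu : R) (hnu : 0 <= nu)
    (alpha : R) (halpha : -1 < alpha) (n : nat) (hn : (1 <= n)%N) :
  (forall p q : {poly R},
     type2_mop nu alpha n n p -> type2_mop nu (alpha + 1) n n.-1 q ->
     forall x : R, (fun y : R => p.[y])^`()%classic x = (2 * n%:R) * q.[x]) /\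
  (forall p q : {poly R},
     type2_mop nu alpha n n.-1 p -> type2_mop nu (alpha + 1) n.-1 n.-1 q ->
     forall x : R, (fun y : R => p.[y])^`()%classic x = (2 * n%:R - 1) * q.[x]).
Proof.
case: n hn => // n _; split=> p q hp hq x; rewrite derive1_horner.
- rewrite (@type2_mop_deriv R nu alpha n.*2.+1 p q) ?hornerZ//.
  + by congr (_ * _); rewrite -natrM mul2n.
  + by rewrite /= uphalf_double doubleK.
  + by rewrite /= uphalf_double doubleK.
- rewrite (@type2_mop_deriv R nu alpha n.*2 p q) ?hornerZ//.
  + by congr (_ * _); rewrite -natrM mul2n doubleS -[in RHS]natr1 addrK.
  + by rewrite /= uphalf_double doubleK.
  + by rewrite /= uphalf_double doubleK.
Qed.
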